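(* Let $k$ be a field, let $G=(V_G,E_G)$ be a graph, let $R=k[x \mid x\in V_G]$, and let $I=I(G)\subseteq R$ be the edge ideal of $G$. Let $b_0\in V_G$, suppose that $N(b_0)=\{b_1,\dots,b_t\}$ is the set of vertices adjacent to $b_0$, and set $f=b_0+b_1+\dots+b_t\in R$. (1) If $G$ is a bipartite graph, then $f$ is regular on $R/I^r$ for all $r\in\mathbb{N}$. (2) Suppose that $G$ contains a unique odd cycle $C$, of length $2k_0+1$, and let $\ell=d(b_0,C)$. Then $f$ is regular on $R/I^r$ for all $r\in\mathbb{N}$ with $r\le k_0+\ell-1$.
   Context: Graphs are finite and simple; vertices are identified with the variables of the polynomial ring $R$ over an arbitrary field. The edge ideal $I(G)$ is the ideal generated by the products $xy$ for all edges $\{x,y\}\in E_G$. Here $\mathbb{N}$ denotes the positive integers. For a vertex $x$ and a subgraph $H$ of $G$, $d(x,H)$ is the minimum length of a path connecting $x$ to a vertex of $H$, with $d(x,H)=\infty$ if no such path exists (in which case the bound on $r$ is vacuous). An element $f$ is regular on $R/J$ if it is a nonzerodivisor on $R/J$ and $R/(J,f)\ne 0$. *)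

(* Defs.v *)
From mathcomp Require Import all_boot all_order all_algebra.
From mathcomp Require Export mpoly.

Set Implicit Arguments.
Unset Strict Implicit.
Unset Printing Implicit Defensive.

Import GRing.Theory.
Local Open Scope ring_scope.

(* A finite simple graph is a symmetric irreflexive relation on a finType. *)

Definition bipartite (V : finType) (e : rel V) : Prop :=
  exists A : {set V}, forall x y, e x y -> (x \in A) != (y \in A).

(* The bound on the size excludes the 2-cycles x, y that ucycle allows. *)
Definition is_cycle (V : finType) (e : rel V) (c : seq V) : Prop :=
  (2 < size c)%N /\ ucycle e c.

(* A cycle of the graph, as a subgraph, has many listings c (one for each
   starting vertex and direction); they are identified by their edge set. *)
Definition cycle_edges (V : finType) (c : seq V) : {set {set V}} :=
  [set [set x; next c x] | x in c].

Definition unique_odd_cycle (V : finType) (e : rel V) (c : seq V) : Prop :=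
  [/\ is_cycle e c, odd (size c) &
      forall c', is_cycle e c' -> odd (size c') ->
        cycle_edges c' = cycle_edges c].

(* x :: p is a path of length size p from x to a vertex of H. *)
Definition path_to (V : finType) (e : rel V) (x : V) (H : {set V})
    (p : seq V) : Prop :=
  [/\ path e x p, uniq (x :: p) & last x p \in H].

(* d(x, H) = l, where None stands for infinity. *)
Definition is_dist (V : finType) (e : rel V) (x : V) (H : {set V})
    (l : option nat) : Prop :=
  match l with
  | Some d => (exists2 p, path_to e x H p & size p = d) /\
              (forall p, path_to e x H p -> (d <= size p)%N)
  | None => forall p, ~ path_to e x H p
  end.

Definition ideal_gen (R : comNzRingType) (S : R -> Prop) (p : R) : Prop :=
  exists n (a s : 'I_n -> R),
    (forall i, S (s i)) /\ p = \sum_(i < n) a i * s i.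

Definition ideal_pow (R : comNzRingType) (I : R -> Prop) (r : nat) :
    R -> Prop :=
  ideal_gen (fun p => exists s : 'I_r -> R,
    (forall i, I (s i)) /\ p = \prod_(i < r) s i).

(* f is regular on R/J, with classes modulo J written through their
   representatives: f * g = 0 in R/J implies g = 0 in R/J, and R/(J, f) is
   nonzero, i.e. 1 is not in (J, f). *)
Definition regular_mod (R : comNzRingType) (J : R -> Prop) (f : R) : Prop :=
  (forall g, J (f * g) -> J g) /\ ~ ideal_gen (fun p => J p \/ p = f) 1.

(* The variable of k[x | x in V] attached to the vertex x. *)
Definition vvar (k : fieldType) (V : finType) (x : V) : {mpoly k[#|V|]} :=
  'X_(enum_rank x).

Definition edge_ideal (k : fieldType) (V : finType) (e : rel V) :
    {mpoly k[#|V|]} -> Prop :=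
  ideal_gen (fun p => exists x y, e x y /\ p = vvar k x * vvar k y).
Arguments edge_ideal k {V} e _.

Definition closed_nbhd_sum (k : fieldType) (V : finType) (e : rel V) (b0 : V) :
    {mpoly k[#|V|]} :=
  vvar k b0 + \sum_(b | e b0 b) vvar k b.
Arguments closed_nbhd_sum k {V} e b0.

(* Main.v *)
Require Import Defs.
From mathcomp Require Import all_boot all_order all_algebra.
From mathcomp Require Import zify.

Set Implicit Arguments.
Unset Strict Implicit.
Unset Printing Implicit Defensive.

Import GRing.Theory.

(** Why the theorem holds. The ideal J = I^r is spanned by monomials, so its
associated primes are generated by variables, and one of them contains
f = b_0 + ... + b_t exactly when it contains every b_i. Regularity of f thus
reduces to a statement about a single monomial: if b_i m lies in J for all i,
then m lies in J ([nonzerodivisor_sum_vars], which proves the reduction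
directly, without associated primes).

A monomial m is a vertex weight, and m lies in I^r exactly when r edges, taken
with repetition, use each vertex at most as often as m allows ([packs]). It is
best seen as a matching with r edges in the graph where each vertex v is
replaced by m v copies.

Suppose that m is not in I^r while every b_i m is. As b_0 m is in I^r, some
r - 1 edges fit in m and leave free a copy of a neighbour u of b_0; as u is
itself one of the b_i, some r - 1 edges fit in m and leave free a copy of a
neighbour y of u. Comparing these two packings by alternating paths
([packs_exchange]) yields a packing of r edges, or a packing of r - 1 edges
that leaves u and y free at once, to which the edge uy can be added, or a walk
of even length at most 2 (r - 1) from u to y. Only the last case is possible,
and closing the walk with the edge yu gives a closed walk of odd length at
most 2 r - 1 through a neighbour u of b_0 ([odd_walk_of_not_packs]).

A bipartite graph has no odd closed walk. If the graph has a unique odd cycle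
C, a closed odd walk through u has length at least |C| + 2 d(u, C)
([odd_walk_cycle]), and in particular exists only if some path joins b_0 to C.
As u is adjacent to b_0, this bound is at least (2 k_0 + 1) + 2 (l - 1)
([odd_walk_length]). Hence r >= k_0 + l, against the hypothesis on r. *)

(** * Packings of edges below a vertex weight *)

Section Packings.
Variables (V : finType) (e : rel V).
Implicit Types (s : seq (V * V)) (m : V -> nat) (w : seq V) (u v x y z : V).

Definition edge_deg s v : nat := \sum_(a <- s) ((a.1 == v) + (a.2 == v)).

(** A matching of size n in the blow-up of the graph along m that leaves the
vertices of w unmatched. Keeping w as a list of reserved vertices spares every
subtraction from m. *)
Definition packs (n : nat) w m : bool :=
  [exists s : n.-tuple (V * V), all (fun a => e a.1 a.2) s &&
     [forall v, edge_deg s v + count_mem v w <= m v]].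

Lemma packsP n w m :
  reflect (exists s, [/\ all (fun a => e a.1 a.2) s, size s = n &
                         forall v, edge_deg s v + count_mem v w <= m v])
          (packs n w m).
Proof.
apply: (iffP existsP) => [[s /andP[es /forallP sm]]|[s [es sn sm]]].
  by exists s; rewrite size_tuple.
have sz : size s == n by apply/eqP.
by exists (Tuple sz); rewrite /= es; apply/forallP.
Qed.

Lemma edge_deg_cons a s v :
  edge_deg (a :: s) v = (a.1 == v) + (a.2 == v) + edge_deg s v.
Proof. by rewrite /edge_deg big_cons. Qed.

Lemma packs_weaken n w w' m m' :
  (forall v, count_mem v w' + m v <= count_mem v w + m' v) ->
  packs n w m -> packs n w' m'.
Proof.
move=> ww /packsP[s [es sn sm]]; apply/packsP; exists s; split=> // v.
by move: (ww v) (sm v); lia.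
Qed.

Lemma packs0 m : packs 0 [::] m.
Proof.
by apply/packsP; exists [::]; split=> // v; rewrite /edge_deg big_nil.
Qed.

Lemma packsD n1 n2 m1 m2 : packs n1 [::] m1 -> packs n2 [::] m2 ->
  packs (n1 + n2) [::] (fun v => m1 v + m2 v).
Proof.
move=> /packsP[s1 [es1 <- sm1]] /packsP[s2 [es2 <- sm2]]; apply/packsP.
exists (s1 ++ s2); rewrite all_cat es1 es2 size_cat; split=> // v.
by move: (sm1 v) (sm2 v); rewrite /edge_deg big_cat /=; lia.
Qed.

Lemma packs_cons n y z w m :
  e y z -> packs n [:: y, z & w] m -> packs n.+1 w m.
Proof.
move=> eyz /packsP[s [es <- sm]]; apply/packsP; exists ((y, z) :: s).
rewrite /= eyz es; split=> // v; move: (sm v).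
by rewrite edge_deg_cons /=; lia.
Qed.

Hypothesis e_sym : symmetric e.

Lemma edge_at s y : all (fun a => e a.1 a.2) s -> 0 < edge_deg s y ->
  exists z s', [/\ all (fun a => e a.1 a.2) s', size s = (size s').+1, e y z &
    forall v, edge_deg s v = (y == v) + (z == v) + edge_deg s' v].
Proof.
elim: s => [|[a b] s IHs] /=; first by rewrite /edge_deg big_nil.
case/andP=> eab es; rewrite edge_deg_cons /=.
have [<- _|nay] := eqVneq a y.
  by exists b, s; split=> // v; rewrite edge_deg_cons.
have [<- _|nby] := eqVneq b y.
  exists a, s; split=> // [|v]; first by rewrite e_sym.
  by rewrite edge_deg_cons /=; lia.
move=> /(IHs es)[z [s' [es' -> eyz sE]]].
exists z, ((a, b) :: s'); split=> //= [|v]; first by rewrite eab.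
by rewrite !edge_deg_cons sE /=; lia.
Qed.

(** If m has a copy of y that is not reserved by w, it is either unused, and can
be reserved too, or matched, and undoing its edge frees it together with the
other end. *)
Lemma packs_spare_or_matched n y w m :
  packs n w m -> count_mem y w < m y ->
  packs n (y :: w) m \/
  exists n' z, [/\ n = n'.+1, e y z & packs n' [:: y, z & w] m].
Proof.
move=> /packsP[s [es <- sm]] wy.
have [sy|sy] := ltnP (edge_deg s y + count_mem y w) (m y).
  left; apply/packsP; exists s; split=> // v /=.
  by have [<-|_] := eqVneq y v; [rewrite add1n addnS | exact: sm].
have [|z [s' [es' ss' eyz sE]]] := edge_at (y := y) es; first by lia.
right; exists (size s'), z; split=> //; apply/packsP; exists s'; split=> // v.
by move: (sm v); rewrite sE /=; lia.
Qed.

(** Multiplying by b gains an edge only if that edge uses the new copy of b; its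
other end z is then left free by the remaining edges. *)
Lemma packs_mul_var n b m :
  packs n [::] (fun v => m v + (b == v)) ->
  packs n [::] m \/
  exists n' z, [/\ n = n'.+1, e b z & packs n' [:: z] m].
Proof.
move=> /packsP[s [es <- sm]].
have [sb|sb] := leqP (edge_deg s b) (m b).
  left; apply/packsP; exists s; split=> // v /=; move: (sm v).
  by have [<-|_] := eqVneq b v; rewrite /=; lia.
have [|z [s' [es' ss' ebz sE]]] := edge_at (y := b) es; first by lia.
right; exists (size s'), z; split=> //; apply/packsP; exists s'; split=> // v.
by move: (sm v); rewrite sE /=; lia.
Qed.

Hypothesis e_irr : irreflexive e.

(** The alternating path from y in the union of the two matchings, followed two
edges at a time: an edge yz of the packing that leaves u free, then an edge zx
of the packing that leaves y free. Reserving y and z brings us back to the same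
situation with x in place of y and one edge less in both packings. If the path
stops at z, it is augmenting; if it stops at an even step away from u, swapping
it frees y as well; otherwise it ends at u and is the even walk. *)
Lemma packs_exchange n u y w m :
  packs n (u :: w) m -> packs n (y :: w) m ->
  [\/ packs n.+1 w m, packs n [:: u, y & w] m |
      exists p, [/\ path e u p, last u p = y, ~~ odd (size p) &
                    size p <= n.*2]].
Proof.
elim: n y w => [|n IHn] y w pu py.
all: have [<-|nuy] := eqVneq u y; first by constructor 3; exists [::].
all: have wy : count_mem y w < m y by
  case/packsP: py => s [_ _ /(_ y)]; rewrite /= eqxx; lia.
all: have [|pyu|[n' [z [nE eyz pz]]]] := packs_spare_or_matched (y := y) pu;
  first by rewrite /= (negPf nuy).
- by constructor 2; apply: packs_weaken pyu => v /=; lia.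
- by [].
- by constructor 2; apply: packs_weaken pyu => v /=; lia.
(* y is matched to z: look for z in the other packing. *)
case: nE pz => <-{n'} pz.
have nyz : y != z by apply: contraTneq eyz => ->; rewrite e_irr.
have wz : count_mem z w < m z.
  by case/packsP: pz => s [_ _ /(_ z)]; rewrite /= eqxx; lia.
have [|pzy|[n' [x [nE ezx px]]]] := packs_spare_or_matched (y := z) py.
- by rewrite /= (negPf nyz).
- by constructor 1; apply: (packs_cons (y := z) (z := y)); rewrite // e_sym.
(* z is matched to x there: set y and z aside and continue from x. *)
case: nE px => <-{n'} px.
have [||pyz|pux|[p [up px' p_even ps]]] := IHn x [:: y, z & w].
- by apply: packs_weaken pz => v /=; lia.
- by apply: packs_weaken px => v /=; lia.
- by constructor 1; apply: packs_cons eyz pyz.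
- (* The edge zx replaces yz, which frees y. *)
  constructor 2; apply: (packs_cons ezx).
  by apply: packs_weaken pux => v /=; lia.
constructor 3; exists (p ++ [:: z; y]); split.
- by rewrite cat_path up px' /= e_sym ezx e_sym eyz.
- by rewrite last_cat.
- by rewrite size_cat oddD (negPf p_even).
by rewrite size_cat /=; lia.
Qed.

(** The obstruction to cancelling the closed neighbourhood of b: the monomial is
multiplied first by b, then by the neighbour u that this leaves free. *)
Lemma odd_walk_of_not_packs n b m :
  ~~ packs n [::] m ->
  (forall x, (x == b) || e b x -> packs n [::] (fun v => m v + (x == v))) ->
  exists u p, [/\ e b u, path e u p, last u p = u, odd (size p) &
                  size p < n.*2].
Proof.
move=> nm mb.
have [||[n' [u [nE ebu pu]]]] := packs_mul_var (mb b _).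
- by rewrite eqxx.
- by rewrite (negPf nm).
have [||[n'' [y [nE' euy py]]]] := packs_mul_var (mb u _).
- by rewrite ebu orbT.
- by rewrite (negPf nm).
subst n; case: nE' py => <-{n''} py.
have [p1|p2|[p [up py' p_even ps]]] := packs_exchange pu py.
- by rewrite p1 in nm.
- by rewrite (packs_cons euy p2) in nm.
exists u, (rcons p u).
rewrite rcons_path last_rcons size_rcons up py' (e_sym y).
by split=> //=; lia.
Qed.

End Packings.

(** * Closed walks of odd length *)

Section OddWalks.
Variables (V : finType) (e : rel V).

Lemma bipartite_closed_walk_even u p :
  bipartite e -> path e u p -> last u p = u -> ~~ odd (size p).
Proof.
case=> A eA up pE.
suff : forall x, path e x p -> (last x p \in A) = (x \in A) (+) odd (size p).
  by move/(_ u up); rewrite pE; case: (u \in A); case: (odd _).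
elim: p {up pE} => [|y p IHp] x /=; first by rewrite addbF.
case/andP=> /eA exy /IHp ->; move: exy.
by case: (x \in A); case: (y \in A); case: (odd _).
Qed.

Hypotheses (e_sym : symmetric e) (e_irr : irreflexive e).

(** A closed walk without repeated vertices is a cycle. Otherwise cut out the
closed walk p2 between two visits of a vertex. If p2 is even, it can be
dropped. If it is odd, it contains the cycle, and the shorter one of the two
remaining pieces p1 and p3, which join u to p2, is at most half of their total
length. *)
Lemma odd_walk_cycle u p :
  path e u p -> last u p = u -> odd (size p) ->
  exists c q, [/\ is_cycle e c, odd (size c), path e u q, last u q \in c &
                  size c + (size q).*2 <= size p].
Proof.
have [N] := ubnP (size p); elim: N u p => // N IHN u p psN up pE p_odd.
have [p_uniq|] := boolP (uniq p).
  have p_cycle : cycle e p.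
    by case: p up pE {psN p_odd p_uniq} => //= y p /andP[uy yp] pu;
      rewrite rcons_path yp pu.
  exists p, [::]; split=> //=; last by lia.
    split; last by rewrite /ucycle p_uniq p_cycle.
    case: p up pE p_odd {psN p_uniq p_cycle} => [|a [|b [|d p]]] //=.
    by move=> + au; rewrite au e_irr.
  rewrite -pE; case: p up pE p_odd {psN p_uniq p_cycle} => //= a p *.
  by rewrite mem_last.
case/(uniqPn u) => i [j [ij jp Eij]].
have ip : i < size p := ltn_trans ij jp.
pose p1 := take i.+1 p; pose p2 := drop i.+1 (take j.+1 p).
pose p3 := drop j.+1 p.
have p12 : p1 ++ p2 = take j.+1 p.
  by rewrite /p1 -(take_takel (j := j.+1)) ?cat_take_drop // ltnW.
have pcat : p = p1 ++ p2 ++ p3 by rewrite catA p12 cat_take_drop.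
have s2 : 0 < size p2 by rewrite size_drop size_takel // subn_gt0.
have l2 : last (last u p1) p2 = last u p1.
  by rewrite -last_cat p12 /p1 !(take_nth u) // !last_rcons.
have s1 : 0 < size p1 by rewrite size_takel.
move: up pE p_odd psN; rewrite pcat !cat_path !last_cat !size_cat l2.
case/and3P=> p1P p2P p3P p3E p_odd psN.
have [odd2|even2] := boolP (odd (size p2)).
  have [|c [q [cC c_odd q_path qc cq]]] := IHN _ _ _ p2P l2 odd2; first by lia.
  have [p13|p31] := leqP (size p1) (size p3).
    exists c, (p1 ++ q); rewrite cat_path p1P last_cat size_cat.
    by split=> //; lia.
  (* Walk p3 backwards, from u to the start of p2. *)
  exists c, (rev (belast (last u p1) p3) ++ q).
  have lr : last u (rev (belast (last u p1) p3)) = last u p1.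
    by case: (p3) p3E => //= a p3'; rewrite rev_cons last_rcons.
  rewrite cat_path last_cat lr size_cat size_rev size_belast.
  split=> //; last by lia.
  rewrite -{1}p3E rev_path q_path andbT.
  by rewrite (eq_path (e' := e)) // => x y; rewrite /= e_sym.
have [||||c [q [cC c_odd q_path qc cq]]] := IHN u (p1 ++ p3) _ _ _ _.
- by rewrite size_cat; lia.
- by rewrite cat_path p1P.
- by rewrite last_cat.
- by rewrite size_cat; move: p_odd; rewrite !oddD (negPf even2).
by exists c, q; split=> //; move: cq; rewrite size_cat; lia.
Qed.

(** Cycles with the same edges thus have the same vertices and the same length,
so that the cycle found in a walk can stand for the unique odd one. *)
Lemma cycle_edgesE (c : seq V) x :
  (x \in c) = (x \in cover (cycle_edges c)).
Proof.
apply/idP/bigcupP => [xc|[E /imsetP[y yc ->]]].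
  by exists [set x; next c x]; [exact: imset_f | rewrite set21].
by rewrite !inE => /orP[] /eqP-> //; rewrite mem_next.
Qed.

Lemma odd_walk_length c l b u p :
  unique_odd_cycle e c -> is_dist e b [set x in c] l ->
  e b u -> path e u p -> last u p = u -> odd (size p) ->
  exists2 d, l = Some d & size c + d.*2 <= size p + 2.
Proof.
case=> [[_ /andP[_ c_uniq]] _ cU] bl ebu up pE p_odd.
have [c' [q [cC c_odd q_path qc cq]]] := odd_walk_cycle up pE p_odd.
have cc : c' =i c by move=> x; rewrite !cycle_edgesE (cU c').
have c'_uniq : uniq c' by case: cC => _ /andP[].
have sc : size c' = size c.
  by apply/esym/eqP; rewrite -(uniq_size_uniq c'_uniq cc).
have bq : path e b (u :: q) by rewrite /= ebu.
have : last b (u :: q) \in [set x in c] by rewrite inE -cc.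
case/shortenP: bq => q' bq' q'_uniq q'_sub q'c.
have q'P : path_to e b [set x in c] q' by [].
have sq : size q' <= (size q).+1.
  by have /andP[_ /uniq_leq_size] := q'_uniq => /(_ _ q'_sub).
case: l bl => [d [_ dmin]|/(_ q')//]; exists d => //.
have dq : d <= (size q).+1 := leq_trans (dmin _ q'P) sq.
by rewrite -sc; lia.
Qed.

End OddWalks.

Local Open Scope ring_scope.

(** * Sums of variables modulo a monomial ideal *)

Section MonomialIdeals.
Variables (n : nat) (R : fieldType).
Implicit Types (J : pred 'X_{1..n}) (p q f g : {mpoly R[n]}) (m : 'X_{1..n}).

(** When J is closed under multiplication by monomials, these are the elements
of the monomial ideal generated by J. *)
Definition spanned J p : Prop := {in msupp p, forall m, J m}.

Lemma spannedP J p : spanned J p <-> (forall m, ~~ J m -> p@_m = 0).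
Proof.
split=> [Jp m|Jp m]; last by rewrite mcoeff_msupp; apply: contra_neqT => /Jp.
by apply: contraNeq; rewrite -mcoeff_msupp => /Jp.
Qed.

Lemma spanned0 J : spanned J 0.
Proof. by move=> m; rewrite msupp0. Qed.

Lemma spannedD J p q : spanned J p -> spanned J q -> spanned J (p + q).
Proof.
by move=> Jp Jq m /msuppD_le; rewrite mem_cat => /orP[/Jp|/Jq].
Qed.

Lemma spannedN J p : spanned J p -> spanned J (- p).
Proof. by move=> Jp m; rewrite (perm_mem (msuppN p)) => /Jp. Qed.

Lemma spannedX J m : J m -> spanned J 'X_[m].
Proof. by move=> Jm m'; rewrite msuppX inE => /eqP->. Qed.

Lemma spanned_sum (I : Type) (r : seq I) (P : pred I) F J :
  (forall i, P i -> spanned J (F i)) -> spanned J (\sum_(i <- r | P i) F i).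
Proof.
by apply: (big_ind (spanned J)); [exact: spanned0 | exact: spannedD].
Qed.

Lemma spannedM J1 J2 J p q : (forall m1 m2, J1 m1 -> J2 m2 -> J (m1 + m2)%MM) ->
  spanned J1 p -> spanned J2 q -> spanned J (p * q).
Proof.
move=> J12 Jp Jq m /msuppM_le /allpairsP[[m1 m2] /= [m1p m2q ->]].
by apply: J12; [exact: Jp | exact: Jq].
Qed.

Definition restrict (P : pred 'X_{1..n}) p : {mpoly R[n]} :=
  \sum_(m <- msupp p | P m) p@_m *: 'X_[m].

Lemma mcoeff_restrict P p m : (restrict P p)@_m = if P m then p@_m else 0.
Proof.
rewrite /restrict raddf_sum /=.
have [mp|mp] := boolP (m \in msupp p); last first.
  rewrite (memN_msupp_eq0 mp) if_same big_seq_cond big1 // => m' /andP[m'p _].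
  by rewrite mcoeffZ mcoeffX; case: eqP m'p mp => [->->//|_ _ _]; rewrite mulr0.
rewrite big_mkcond (bigD1_seq m) //= mcoeffZ mcoeffX eqxx mulr1 big1 ?addr0 //.
move=> m' m'm; case: ifP => // _.
by rewrite mcoeffZ mcoeffX (negPf m'm) mulr0.
Qed.

Lemma mem_msupp_restrict P p m :
  (m \in msupp (restrict P p)) = P m && (m \in msupp p).
Proof.
by rewrite !mcoeff_msupp mcoeff_restrict; case: (P m); rewrite ?eqxx.
Qed.

Lemma restrictC P p : p = restrict P p + restrict (predC P) p.
Proof.
apply/mpolyP => m; rewrite mcoeffD !mcoeff_restrict /=.
by case: (P m); rewrite /= ?addr0 ?add0r.
Qed.

Section SumOfVariables.
Variables (J : pred 'X_{1..n}) (B : pred 'I_n).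
Hypothesis J_up : forall m m', J m -> J (m + m')%MM.
(* That is, no associated prime of J contains all the variables of B. *)
Hypothesis J_colon : forall m, (forall i, B i -> J (m + U_(i))%MM) -> J m.
Let f : {mpoly R[n]} := \sum_(i < n | B i) 'X_i.

Lemma spannedMl p q : spanned J q -> spanned J (p * q).
Proof.
move=> Jq; rewrite mulrC.
apply: (@spannedM J xpredT J q p _ Jq) => // m1 m2 Jm1 _.
exact: J_up.
Qed.

(** The number of terms of g is decreased as long as some variable of B, applied
to g, sends some terms into J but not all: the terms that stay outside J form
a smaller counterexample. Once every variable of B acts on all terms of g in the
same way, those that send g into J can be removed from f. By [J_colon] the
remaining sum f' is nonzero, no monomial of f' * g is in J, and therefore
f' * g = 0, which is impossible in a domain. *)
Lemma nonzerodivisor_disjoint g :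
  (forall m, m \in msupp g -> ~~ J m) -> spanned J (f * g) -> g = 0.
Proof.
have [N] := ubnP (size (msupp g)); elim: N g => // N IHN g gN gJ fgJ.
apply/eqP/negPn/negP => g_neq0.
have [splits|pure] := boolP [exists i, [&& B i,
    has (fun m => J (m + U_(i))%MM) (msupp g)
  & has (fun m => ~~ J (m + U_(i))%MM) (msupp g)]].
  case/existsP: splits => i /and3P[Bi /hasP[m1 m1g Jm1] /hasP[m2 m2g Jm2]].
  pose P m := ~~ J (m + U_(i))%MM.
  have sX : perm_eq (msupp (restrict P g * 'X_i))
                    [seq (U_(i) + m')%MM | m' <- msupp (restrict P g)].
    exact: msuppMX.
  have : restrict P g * 'X_i = 0.
    apply: IHN.
    - rewrite (perm_size sX) size_map.
      apply: leq_trans (_ : size (msupp g) <= N)%N => //.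
      have /uniq_leq_size : uniq (m1 :: msupp (restrict P g)).
        by rewrite /= mem_msupp_restrict /P Jm1 /= msupp_uniq.
      apply=> m; rewrite inE mem_msupp_restrict.
      by case/predU1P => [->//|/andP[]].
    - move=> m; rewrite (perm_mem sX) => /mapP[m' m'g ->].
      by move: m'g; rewrite mem_msupp_restrict addmC => /andP[].
    have -> : restrict P g = g - restrict (predC P) g.
      by rewrite {2}(restrictC P g) addrK.
    rewrite mulrBl mulrBr; apply: spannedD.
      by rewrite mulrA mulrC; apply: spannedMl.
    apply/spannedN/spannedMl => m; rewrite (perm_mem (msuppMX _ _)).
    case/mapP => m'; rewrite mem_msupp_restrict /P /= negbK => /andP[Jm' _] ->.
    by rewrite addmC.
  move=> /(congr1 (mcoeff (U_(i) + m2))); rewrite mcoeff0.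
  rewrite mcoeffMX mcoeff_restrict /P Jm2 => /eqP.
  by apply/negP; rewrite -mcoeff_msupp.
case m0E : (msupp g) => [|m0 s0].
  by rewrite -msupp_eq0 m0E in g_neq0.
have m0g : m0 \in msupp g by rewrite m0E mem_head.
have [i0 Bi0 Jm0] : exists2 i, B i & ~~ J (m0 + U_(i))%MM.
  apply/exists_inP; rewrite -negb_forall_in; apply: contra (gJ _ m0g).
  by move/forall_inP; apply: J_colon.
(* All terms of g behave as m0 does. *)
pose B' i := B i && ~~ J (m0 + U_(i))%MM.
have pureE i m : B i -> m \in msupp g -> J (m + U_(i))%MM = J (m0 + U_(i))%MM.
  move=> Bi mg; case Jm: (J (m + _)%MM); case Ji: (J (m0 + _)%MM) => //.
    case/negP: pure; apply/existsP; exists i; rewrite Bi /=.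
    by apply/andP; split; apply/hasP; [exists m | exists m0; rewrite ?Ji].
  case/negP: pure; apply/existsP; exists i; rewrite Bi /=.
  by apply/andP; split; apply/hasP; [exists m0 | exists m; rewrite ?Jm].
pose f' : {mpoly R[n]} := \sum_(i < n | B' i) 'X_i.
have f'gJ : spanned J (f' * g).
  have -> : f' = f - \sum_(i < n | B i && J (m0 + U_(i))%MM) 'X_i.
    by rewrite /f (bigID (fun i => J (m0 + U_(i))%MM)) /= addrC addrK.
  rewrite mulrBl; apply: spannedD => //; apply: spannedN.
  rewrite mulr_suml; apply: spanned_sum => i /andP[Bi Ji] m.
  rewrite mulrC (perm_mem (msuppMX _ _)) => /mapP[m' m'g ->].
  by rewrite addmC pureE.
have f'gNJ m : m \in msupp (f' * g) -> ~~ J m.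
  rewrite mulr_suml => /msupp_sum_le /flatten_mapP[i].
  rewrite mem_filter => /andP[/andP[Bi Ji] _].
  rewrite mulrC (perm_mem (msuppMX _ _)) => /mapP[m' m'g ->].
  by rewrite addmC pureE.
have : f' * g = 0.
  apply/eqP; rewrite -msupp_eq0; case sE : (msupp _) => [//|m s].
  have ms : m \in msupp (f' * g) by rewrite sE mem_head.
  by have := f'gNJ _ ms; rewrite f'gJ.
move/eqP; rewrite mulf_eq0 (negPf g_neq0) orbF; apply/negP.
have: f'@_U_(i0) != 0.
  rewrite raddf_sum (bigD1 i0) /=; last by rewrite /B' Bi0.
  rewrite mcoeffXU eqxx big1 ?addr0 ?oner_neq0 // => i /andP[_ ii0].
  by rewrite mcoeffXU (negPf ii0).
by apply: contra_neq => ->; rewrite mcoeff0.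
Qed.

Lemma nonzerodivisor_sum_vars g : spanned J (f * g) -> spanned J g.
Proof.
move=> fgJ; apply/spannedP => m Jm.
suff : restrict (predC J) g = 0.
  by move/(congr1 (mcoeff m)); rewrite mcoeff0 mcoeff_restrict /= Jm.
apply: nonzerodivisor_disjoint => [m'|].
  by rewrite mem_msupp_restrict => /andP[].
have -> : restrict (predC J) g = g - restrict J g.
  by rewrite {2}(restrictC J g) addrC addKr.
rewrite mulrBr; apply: spannedD => //; apply/spannedN/spannedMl => m'.
by rewrite mem_msupp_restrict => /andP[].
Qed.

End SumOfVariables.
End MonomialIdeals.

(** * Ideals given by generators *)

Section GeneratedIdeals.
Variables (R : comNzRingType) (S : R -> Prop).

Lemma ideal_gen0 : ideal_gen S 0.
Proof.
exists 0%N, (fun=> 0), (fun=> 0); rewrite big_ord0.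
by split=> // -[].
Qed.

Lemma ideal_genD p q : ideal_gen S p -> ideal_gen S q -> ideal_gen S (p + q).
Proof.
move=> [m [a [s [sS ->]]]] [n [b [t [tS ->]]]].
pose glue (u : 'I_m -> R) (v : 'I_n -> R) (i : 'I_(m + n)) :=
  match split i with inl j => u j | inr j => v j end.
exists (m + n)%N, (glue a b), (glue s t); split=> [i|].
  by rewrite /glue; case: split.
rewrite big_split_ord /glue; congr (_ + _); apply: eq_bigr => i _.
  by rewrite -/(unsplit (inl i)) unsplitK.
by rewrite -/(unsplit (inr i)) unsplitK.
Qed.

Lemma ideal_gen_mulr a x : S x -> ideal_gen S (a * x).
Proof.
by move=> Sx; exists 1%N, (fun=> a), (fun=> x); rewrite big_ord1.
Qed.

Lemma ideal_gen_ind (P : R -> Prop) p : P 0 ->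
  (forall x y, P x -> P y -> P (x + y)) -> (forall a x, S x -> P (a * x)) ->
  ideal_gen S p -> P p.
Proof.
move=> P0 PD PS [n [a [s [sS ->]]]].
by apply: (big_ind P) => // i _; apply: PS.
Qed.

End GeneratedIdeals.

(** * Powers of the edge ideal *)

Section EdgeIdealPowers.
Variables (k : fieldType) (V : finType) (e : rel V).

Definition expo (m : 'X_{1..#|V|}) (v : V) : nat := m (enum_rank v).

Definition power_monomial r : pred 'X_{1..#|V|} :=
  fun m => packs e r [::] (expo m).

Lemma power_monomialD r1 r2 m1 m2 : power_monomial r1 m1 ->
  power_monomial r2 m2 -> power_monomial (r1 + r2) (m1 + m2)%MM.
Proof.
move=> p1 p2; apply: packs_weaken (packsD p1 p2) => v.
by rewrite /expo mnmDE.
Qed.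

Lemma power_monomial_up r m m' :
  power_monomial r m -> power_monomial r (m + m')%MM.
Proof.
by move=> rm; rewrite -[r]addn0; apply: power_monomialD => //; apply: packs0.
Qed.

Lemma edge_ideal_spanned p : edge_ideal k e p -> spanned (power_monomial 1) p.
Proof.
apply: ideal_gen_ind => [|x y|a x [u [v [euv ->]]]].
- exact: spanned0.
- exact: spannedD.
apply: spannedMl; first by move=> *; apply: power_monomial_up.
rewrite /vvar -mpolyXD; apply: spannedX.
apply: (packs_cons euv).
apply: (packs_weaken (w := [::])) (packs0 _ (fun=> 0%N)).
by move=> w /=; rewrite /expo mnmDE !mnm1E !(inj_eq enum_rank_inj); lia.
Qed.

Lemma ideal_pow_spanned r p :
  ideal_pow (edge_ideal k e) r p -> spanned (power_monomial r) p.
Proof.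
apply: ideal_gen_ind => [|x y|a x [s [sI ->]]].
- exact: spanned0.
- exact: spannedD.
apply: spannedMl; first by move=> *; apply: power_monomial_up.
elim: r s sI => [|r IHr] s sI.
  by rewrite big_ord0 -mpolyX0; apply/spannedX/packs0.
rewrite big_ord_recl.
apply: spannedM (edge_ideal_spanned (sI _)) (IHr _ _) => //.
exact: power_monomialD.
Qed.

Lemma power_monomial_ideal_pow r c m : power_monomial r m ->
  ideal_pow (edge_ideal k e) r (c *: 'X_[m]).
Proof.
case/packsP=> s [es sr sm].
pose em a : 'X_{1..#|V|} := (U_(enum_rank a.1) + U_(enum_rank a.2))%MM.
pose ms := (\big[+%MM/0%MM]_(a <- s) em a)%MM.
have ms_le : (ms <= m)%MM.
  apply/mnm_lepP => i; move: (sm (enum_val i)).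
  rewrite addn0 /expo enum_valK mnm_sumE; apply: leq_trans.
  rewrite /edge_deg leq_eqVlt; apply/orP; left; apply/eqP/eq_bigr => a _.
  by rewrite mnmDE !mnm1E !(can2_eq (@enum_rankK _) (@enum_valK _)).
rewrite -(submK ms_le) mpolyXD scalerAl; apply: ideal_gen_mulr.
rewrite (big_morph _ (@mpolyXD _ k) (@mpolyX0 _ k)); subst r.
exists (fun i => 'X_[em (tnth (in_tuple s) i)]); split=> [i|]; last first.
  by rewrite big_tnth.
have /(allP es) eab := mem_tnth i (in_tuple s).
rewrite -['X_[_]]mul1r mpolyXD; apply: ideal_gen_mulr.
by exists (tnth (in_tuple s) i).1, (tnth (in_tuple s) i).2.
Qed.

Lemma ideal_powP r p :
  ideal_pow (edge_ideal k e) r p <-> spanned (power_monomial r) p.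
Proof.
split=> [|rp]; first exact: ideal_pow_spanned.
rewrite (mpolyE p) big_seq_cond.
apply: (big_ind (ideal_pow (edge_ideal k e) r)).
- exact: ideal_gen0.
- exact: ideal_genD.
by move=> m /andP[/rp ? _]; apply: power_monomial_ideal_pow.
Qed.

Lemma closed_nbhd_sumE b0 (e_irr : irreflexive e) :
  closed_nbhd_sum k e b0 =
  \sum_(i < #|V| | (enum_val i == b0) || e b0 (enum_val i)) 'X_i.
Proof.
rewrite /closed_nbhd_sum /vvar.
rewrite [RHS](reindex enum_rank) /=; last first.
  by exists enum_val => i _; rewrite ?enum_rankK ?enum_valK.
rewrite [RHS](bigD1 b0) /= ?enum_rankK ?eqxx //; congr (_ + _).
apply: eq_bigl => b; rewrite enum_rankK.
by have [->|] := eqVneq b b0; rewrite /= ?e_irr ?andbT.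
Qed.

(** Both I^r and f lie in the ideal of polynomials without constant term. *)
Lemma proper_ideal_pow_nbhd r b0 : (0 < r)%N ->
  ~ ideal_gen (fun p => ideal_pow (edge_ideal k e) r p
                        \/ p = closed_nbhd_sum k e b0) 1.
Proof.
move=> r_gt0.
pose noconst (m : 'X_{1..#|V|}) := m != 0%MM.
have up m m' : noconst m -> noconst (m + m')%MM.
  by rewrite /noconst mnmD_eq0 negb_and => ->.
have nX i : spanned noconst ('X_i : {mpoly k[#|V|]}).
  by apply: spannedX; rewrite /noconst mnm1_eq0.
suff noc p : ideal_gen (fun p => ideal_pow (edge_ideal k e) r p
    \/ p = closed_nbhd_sum k e b0) p -> spanned noconst p.
  by move/noc/(_ 0%MM); rewrite msupp1 /noconst mem_head eqxx => /(_ isT).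
apply: ideal_gen_ind => [|x y|a x Jx].
- exact: spanned0.
- exact: spannedD.
apply: spannedMl => //; case: Jx => [/ideal_powP Jx m /Jx|->].
  apply: contraTneq => ->; apply/packsP => -[[|[a' b'] s] [_ sr sm]].
    by rewrite -sr in r_gt0.
  by move: (sm a'); rewrite edge_deg_cons /expo mnm0E /= eqxx; lia.
by apply: spannedD; [exact: nX | apply: spanned_sum => b _; exact: nX].
Qed.

Lemma regular_mod_of_packs r b0 :
  irreflexive e -> (0 < r)%N ->
  (forall m, (forall x, (x == b0) || e b0 x ->
                packs e r [::] (fun v => m v + (x == v))%N) ->
     packs e r [::] m) ->
  regular_mod (ideal_pow (edge_ideal k e) r) (closed_nbhd_sum k e b0).
Proof.
move=> e_irr r_gt0 colon; split=> [g|]; last exact: proper_ideal_pow_nbhd.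
rewrite closed_nbhd_sumE // => /ideal_powP fg; apply/ideal_powP.
apply: nonzerodivisor_sum_vars fg => [m m'|m mB].
  exact: power_monomial_up.
apply: colon => x Bx; have := mB (enum_rank x); rewrite enum_rankK => /(_ Bx).
apply: packs_weaken => v; rewrite leq_add2l /expo mnmDE mnm1E.
by rewrite (inj_eq enum_rank_inj).
Qed.

End EdgeIdealPowers.

Theorem theorem2p1 (k : fieldType) (V : finType) (e : rel V)
    (e_sym : symmetric e) (e_irr : irreflexive e) (b0 : V) :
  (bipartite e ->
     forall r : nat, (0 < r)%N ->
       regular_mod (ideal_pow (edge_ideal k e) r) (closed_nbhd_sum k e b0)) /\
  (forall (c : seq V) (k0 : nat) (l : option nat),
     unique_odd_cycle e c ->
     size c = (2 * k0 + 1)%N ->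
     is_dist e b0 [set x in c] l ->
     forall r : nat, (0 < r)%N ->
       (if l is Some d then (r <= k0 + d - 1)%N else true) ->
       regular_mod (ideal_pow (edge_ideal k e) r) (closed_nbhd_sum k e b0)).
Proof.
split=> [bip r r_gt0|c k0 l cU ck0 dl r r_gt0 rl].
all: apply: regular_mod_of_packs => //.
  move=> m colon; apply: contraT => nm.
  have [u [p [_ up pE p_odd _]]] := odd_walk_of_not_packs e_sym e_irr nm colon.
  by have := bipartite_closed_walk_even bip up pE; rewrite p_odd.
move=> m colon; apply: contraT => nm.
have [u [p [ebu up pE p_odd pr]]] := odd_walk_of_not_packs e_sym e_irr nm colon.
have [d lE] := odd_walk_length e_sym e_irr cU dl ebu up pE p_odd.
have c_gt2 : (2 < size c)%N by case: cU => -[].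
by rewrite lE in rl; lia.
Qed.
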